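(* Let $G$ be a finite group, let $V$ be a finite-dimensional real representation of $G$ with a basis $\mathcal B$, and let $\tilde f:V\to V$ be a $G$-equivariant point-wise activation induced on $\mathcal B$ by a continuous function $f:\mathbb R\to\mathbb R$ that is neither odd nor affine. Then the representation $V$ (with the basis $\mathcal B$) is disentangled if and only if $V$ is a sum of trivial representations.
   Context: For a basis $\mathcal B=\{v_1,\dots,v_d\}$ of $V$ and $f:\mathbb R\to\mathbb R$, the point-wise activation induced by $f$ on $\mathcal B$ is $\tilde f(a_1v_1+\cdots+a_dv_d)=f(a_1)v_1+\cdots+f(a_d)v_d$; it is $G$-equivariant if $\tilde f(gv)=g\tilde f(v)$ for all $g\in G$, $v\in V$. A function is odd if $f(-x)=-f(x)$ for all $x$, and affine if it has the form $x\mapsto ax+c$. The representation $V$, with the basis $\mathcal B$ used to define the activation, is disentangled if $V$ is given as a direct sum of irreducible subrepresentations such that each vector of $\mathcal B$ is contained in a single irreducible component. A trivial representation is a one-dimensional representation on which every $g\in G$ acts as the identity. *)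

(* Defs.v *)
From HB Require Import structures.
From mathcomp Require Import all_boot all_order all_algebra all_fingroup all_character.
From mathcomp Require Import all_classical all_reals all_analysis.

Set Implicit Arguments.
Unset Strict Implicit.
Unset Printing Implicit Defensive.

Import Order.TTheory GRing.Theory Num.Theory.
Import numFieldNormedType.Exports.

Local Open Scope ring_scope.

Definition odd_function (R : realType) (f : R -> R) : Prop :=
  forall x, f (- x) = - f x.

Definition affine_function (R : realType) (f : R -> R) : Prop :=
  exists a c : R, forall x, f x = a * x + c.

(* A d-dimensional real representation of G is an [mx_representation R G d]
   with underlying space V = 'rV[R]_d, on which g \in G acts by
   v |-> v *m rG g. Since (v *m rG g) *m rG h = v *m rG (g * h), the left
   action g.v is v *m rG g^-1; quantifying over all g in G, equivariance,
   subrepresentations and trivial actions are the same for both. *)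

Definition pointwise_activation (R : realType) (d : nat)
    (b : d.-tuple 'rV[R]_d) (f : R -> R) (v : 'rV[R]_d) : 'rV[R]_d :=
  \sum_(i < d) f (coord b i v) *: tnth b i.

Definition equivariant (R : realType) (gT : finGroupType) (G : {group gT})
    (d : nat) (rG : mx_representation R G d)
    (phi : 'rV[R]_d -> 'rV[R]_d) : Prop :=
  forall g, g \in G -> forall v, phi (v *m rG g) = phi v *m rG g.

(* Subspaces of V are row spaces of square matrices. *)
Definition direct_sum_decomposition (R : realType) (d m : nat)
    (U : 'I_m -> 'M[R]_d) : Prop :=
  (\sum_(i < m) U i == 1%:M)%MS /\ mxdirect (\sum_(i < m) U i).

Definition disentangled (R : realType) (gT : finGroupType) (G : {group gT})
    (d : nat) (rG : mx_representation R G d) (b : d.-tuple 'rV[R]_d) : Prop :=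
  exists (m : nat) (U : 'I_m -> 'M[R]_d),
    [/\ direct_sum_decomposition U,
        forall i, mxsimple rG (U i)
      & forall v, v \in b -> exists! i : 'I_m, (v <= U i)%MS].

Definition trivial_subrepresentation (R : realType) (gT : finGroupType)
    (G : {group gT}) (d : nat) (rG : mx_representation R G d)
    (U : 'M[R]_d) : Prop :=
  [/\ mxmodule rG U,
      \rank U = 1%N
    & forall g, g \in G ->
        forall v : 'rV[R]_d, (v <= U)%MS -> v *m rG g = v].

Definition sum_of_trivial_representations (R : realType) (gT : finGroupType)
    (G : {group gT}) (d : nat) (rG : mx_representation R G d) : Prop :=
  exists (m : nat) (U : 'I_m -> 'M[R]_d),
    direct_sum_decomposition U /\
    forall i, trivial_subrepresentation rG (U i).

(* Main.v *)
Require Import Defs.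
From HB Require Import structures.
From mathcomp Require Import all_boot all_order all_algebra all_fingroup all_character.
From mathcomp Require Import all_classical all_reals all_analysis.
From mathcomp Require Import ring.
Import Order.TTheory GRing.Theory Num.Theory.
Import numFieldNormedType.Exports.
Local Open Scope ring_scope.

Set Implicit Arguments.
Unset Strict Implicit.

(* Written in the basis b, equivariance says that every coordinate form
   x |-> \sum_i m_i x_i of v |-> v.g commutes with f. Two nonzero m_i would turn
   this into Cauchy's equation for f - f 0, so f would be affine. Hence if the
   diagonal entry m_j is nonzero it is the only one, it is a real root of unity,
   and m_j = -1 would make f odd: diagonal entries are 0 or 1. The sum of the
   translates of b_j is thus a nonzero G-fixed vector, lying in any irreducible
   component that contains b_j, and this component must be fixed by G. *)

Lemma additive_ratr (R : realType) (h : {additive R -> R}) (q : rat) :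
  h (ratr q) = ratr q * h 1.
Proof.
have dq0 : (denq q)%:~R != 0 :> R by rewrite intr_eq0 denq_neq0.
have qdq : ratr q * (denq q)%:~R = (numq q)%:~R :> R by rewrite /ratr divfK.
apply: (mulIf dq0); rewrite mulrAC qdq mulrzr -(raddfMz h) mulrzl.
by rewrite -[_ *~ denq q]mulrzr qdq raddfMz.
Qed.

(** The defect [k y = h y - y * h 1] is continuous and vanishes at every rational. If it were
    nonzero at [x], the open set where it is nonzero would contain a rational. *)
Lemma continuous_additive_linear (R : realType) (h : {additive R -> R}) (x : R) :
  continuous h -> h x = x * h 1.
Proof.
move=> hC; apply/eqP; apply: contraT => hx.
pose k (y : R) : R := h y - y * h 1.
have kC : continuous k.
  move=> y; apply: cvgB; first exact: hC.
  by apply: cvgM; [exact: cvg_id | exact: cvg_cst].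
have O : open [set y | k y != 0]%classic.
  have /continuousP kO := kC; apply: (kO [set z | z != 0]%classic); exact: open_neq.
have [|y [ky [q _ qy]]] := dense_rat _ O; first by exists x; rewrite /= subr_eq0.
move: ky; rewrite /= -qy.
by rewrite /k additive_ratr subrr eqxx.
Qed.

Lemma affine_of_two_term_equation (R : realType) (f : R -> R) (a b c : R) :
  continuous f -> a != 0 -> b != 0 ->
  (forall x y, f (a * x + b * y) = a * f x + b * f y + c) ->
  affine_function f.
Proof.
move=> fC a0 b0 E.
(* Subtracting [f 0] absorbs [c]. Setting one variable to 0 then gives [h (a * x) = a * h x], and
   likewise for [b], so rescaling the arguments by [a] and [b] makes [h] additive. *)
pose h x := f x - f 0.
have Eh x y : h (a * x + b * y) = a * h x + b * h y.
  have := E 0 0; rewrite !mulr0 addr0 => E0.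
  by rewrite /h {1}E {1}E0; ring.
have h0 : h 0 = 0 by rewrite /h subrr.
have hD : nmod_morphism h.
  split=> // x y.
  have Ea := Eh (x / a) 0; have Eb := Eh 0 (y / b).
  have := Eh (x / a) (y / b).
  rewrite !(mulr0, h0, addr0, add0r) in Ea Eb.
  by rewrite -Ea -Eb ![_ * (_ / _)]mulrC !divfK.
pose hA : {additive R -> R} := HB.pack h (GRing.isNmodMorphism.Build R R h hD).
have hC : continuous hA.
  by move=> x; apply: cvgB; [exact: fC | exact: cvg_cst].
exists (h 1), (f 0) => x.
by rewrite mulrC -(continuous_additive_linear x hC) /= /h subrK.
Qed.

Lemma affine_of_two_coefficients (R : realType) (f : R -> R) (I : finType)
    (m : I -> R) (j k : I) :
  continuous f -> j != k -> m j != 0 -> m k != 0 ->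
  (forall x : I -> R, f (\sum_i x i * m i) = \sum_i f (x i) * m i) ->
  affine_function f.
Proof.
move=> fC jk mj mk E.
(* At a point supported on [j] and [k], every other coordinate still contributes [f 0 * m i], as
   [f 0] may be nonzero. These terms form the constant. *)
pose c := \sum_(i | (i != j) && (i != k)) f 0 * m i.
apply: (affine_of_two_term_equation (c := c) fC mj mk) => x y.
have := E (fun i => if i == j then x else if i == k then y else 0).
have kj : k != j by rewrite eq_sym.
rewrite (bigD1 j)//= (bigD1 k)//= [X in _ + (_ + X)]big1 => [|i].
  rewrite !eqxx (negPf kj) addr0 ![m _ * _]mulrC => ->.
  rewrite (bigD1 j)//= (bigD1 k)//= !eqxx (negPf kj) -addrA.
  congr (_ + (_ + _)); apply: eq_bigr => i.
  by case/andP=> /negPf -> /negPf ->.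
by case/andP=> /negPf -> /negPf ->; rewrite mul0r.
Qed.

Section Activation.

Variables (R : realType) (gT : finGroupType) (G : {group gT}) (d : nat).
Variables (rG : mx_representation R G d) (b : d.-tuple 'rV[R]_d).
Hypothesis b_basis : basis_of fullv b.

Lemma coord_mulmx (g : gT) (j : 'I_d) (v : 'rV[R]_d) :
  coord b j (v *m rG g) = \sum_i coord b i v * coord b j (b`_i *m rG g).
Proof.
rewrite {1}(coord_basis b_basis (memvf v)) mulmx_suml linear_sum.
by apply: eq_bigr => i _; rewrite -scalemxAl linearZ.
Qed.

Lemma coord_activation (f : R -> R) (j : 'I_d) (v : 'rV[R]_d) :
  coord b j (pointwise_activation b f v) = f (coord b j v).
Proof.
rewrite /pointwise_activation.
under eq_bigr do rewrite (tnth_nth 0).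
by rewrite coord_sum_free ?(basis_free b_basis).
Qed.

Lemma diagonal_coef01 (f : R -> R) (g : gT) (j : 'I_d) :
  continuous f -> ~ odd_function f -> ~ affine_function f ->
  equivariant rG (pointwise_activation b f) -> g \in G ->
  coord b j (b`_j *m rG g) = 0 \/ coord b j (b`_j *m rG g) = 1.
Proof.
move=> fC fodd faff eqv gG.
pose m i := coord b j (b`_i *m rG g).
rewrite -/(m j); case: (eqVneq (m j) 0) => [|mj]; [by left | right].
have E (x : 'I_d -> R) : f (\sum_i x i * m i) = \sum_i f (x i) * m i.
  have fr := basis_free b_basis.
  have := congr1 (coord b j) (eqv g gG (\sum_i x i *: b`_i)).
  rewrite coord_activation !coord_mulmx.
  under eq_bigr do rewrite coord_sum_free//.
  by under [RHS]eq_bigr do rewrite coord_activation coord_sum_free//.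
have m0 i : i != j -> m i = 0.
  move=> ij; apply/eqP; apply: contraT => mi; case: faff.
  apply: (affine_of_two_coefficients fC _ mj mi E).
  by rewrite eq_sym.
have coordg v : coord b j (v *m rG g) = m j * coord b j v.
  rewrite coord_mulmx (bigD1 j)//= big1 ?addr0 1?mulrC// => i /m0.
  by rewrite /m => ->; rewrite mulr0.
(* The [j]-th coordinate form is an eigenvector of the dual action of [g], so the diagonal entry is
   multiplicative along powers of [g]. *)
have coordgX n : coord b j (b`_j *m rG (g ^+ n)%g) = m j ^+ n.
  elim: n => [|n IHn].
    by rewrite expg0 repr_mx1 mulmx1 coord_free ?eqxx ?(basis_free b_basis).
  by rewrite expgSr repr_mxM ?groupX// mulmxA coordg IHn exprS.
have fM x : f (m j * x) = m j * f x.
  have := E (fun i => if i == j then x else 0).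
  rewrite (bigD1 j)//= big1 => [|i ij]; last by rewrite m0 ?mulr0.
  rewrite (bigD1 j)//= big1 => [|i ij]; last by rewrite m0 ?mulr0.
  by rewrite eqxx !addr0 ![_ * m j]mulrC.
(* Take [n] to be the order of [g]: then [m j ^+ n = 1]. *)
have norm1 : `|m j| = 1.
  apply/eqP; rewrite -(@pexpr_eq1 _ _ #[g]%g) ?order_gt0//.
  by rewrite -normrX -coordgX expg_order repr_mx1 mulmx1 coord_free
    ?(basis_free b_basis)// eqxx normr1.
case: (ger0P (m j)) norm1 => // _ mjN.
have mj1 : m j = -1 by rewrite -mjN opprK.
by case: fodd => x; have := fM x; rewrite mj1 !mulN1r.
Qed.

Lemma disentangled_fixed (f : R -> R) (g : gT) :
  continuous f -> ~ odd_function f -> ~ affine_function f ->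
  equivariant rG (pointwise_activation b f) ->
  disentangled rG b -> g \in G -> rG g = 1%:M.
Proof.
move=> fC fodd faff eqv [n [U [_ Usimple Ub]]].
suff : (1%:M <= rfix_mx rG G)%MS.
  by move/rfix_mxP => fixG gG; rewrite -[LHS]mul1mx fixG.
suff bfix (j : 'I_d) : (b`_j <= rfix_mx rG G)%MS.
  apply/row_subP => i.
  rewrite (coord_basis b_basis (memvf (row i 1%:M))).
  by apply: summx_sub => j _; apply: scalemx_sub.
have bj : b`_j \in b by rewrite mem_nth// size_tuple.
have [i [bU _]] := Ub _ bj.
have [Umod _ Umin] := Usimple i.
pose w := \sum_(h in G) b`_j *m rG h.
have wfix : (w <= rfix_mx rG G)%MS.
  apply/rfix_mxP => h hG.
  rewrite /w mulmx_suml [RHS](reindex_inj (mulIg h))/=.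
  apply: eq_big => [k|k kG]; first by rewrite groupMr.
  by rewrite -mulmxA repr_mxM.
have wU : (w <= U i)%MS.
  by apply: summx_sub => h hG; apply: (mxmodule_trans Umod).
(* The [j]-th coordinate of [w] is a sum of diagonal entries, each 0 or 1, and the identity of [G]
   contributes 1. *)
have w0 : w != 0.
  apply: contraTneq (ltr01 : 0 < 1 :> R) => w0; rewrite -leNgt.
  have <- : coord b j w = 0 by rewrite w0 linear0.
  rewrite /w linear_sum (bigD1 1%g)//= repr_mx1 mulmx1.
  rewrite coord_free ?(basis_free b_basis)// eqxx lerDl.
  apply: sumr_ge0 => h /andP[hG _].
  by case: (diagonal_coef01 j fC fodd faff eqv hG) => ->.
(* The fixed vectors in [U i] form a submodule containing [w], so by simplicity they are all of
   [U i], which contains the basis vector. *)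
apply: submx_trans bU (submx_trans _ (capmxSr (U i) (rfix_mx rG G))).
apply: Umin; [exact: capmx_module Umod (rfix_mx_module rG) | exact: capmxSl |].
have wcap : (w <= U i :&: rfix_mx rG G)%MS by rewrite sub_capmx wU wfix.
by apply: contraNneq w0 => cap0; rewrite cap0 submx0 in wcap.
Qed.

Lemma sum_of_trivial_fixed (g : gT) :
  sum_of_trivial_representations rG -> g \in G -> rG g = 1%:M.
Proof.
move=> [n [U [[/eqmxP U1 _] Ut]]] gG.
suff : (1%:M <= rfix_mx rG G)%MS.
  by move/rfix_mxP => fixG; rewrite -[LHS]mul1mx fixG.
rewrite -U1; apply/sumsmx_subP => i _; apply/row_subP => k.
apply/rfix_mxP => h hG; have [_ _] := Ut i.
by apply; rewrite ?row_sub.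
Qed.

Lemma fixed_mxmodule (U : 'M[R]_d) :
  (forall g, g \in G -> rG g = 1%:M) -> mxmodule rG U.
Proof. by move=> G1; apply/mxmoduleP => g gG; rewrite G1// mulmx1. Qed.

Lemma rank_basis_vector (i : 'I_d) : \rank b`_i = 1%N.
Proof.
rewrite rank_rV; suff -> : b`_i != 0 by [].
by apply: (free_not0 (basis_free b_basis)); rewrite mem_nth// size_tuple.
Qed.

Lemma basis_direct_sum_decomposition :
  direct_sum_decomposition (fun i : 'I_d => <<b`_i>>%MS).
Proof.
have full : (\sum_(i < d) <<b`_i>> == 1%:M)%MS.
  apply/andP; split; first exact: submx1.
  apply/row_subP => i.
  rewrite (coord_basis b_basis (memvf (row i 1%:M))).
  apply: summx_sub => j _; apply: scalemx_sub.
  by rewrite (sumsmx_sup j)// genmxE.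
(* Directness is a dimension count: [d] lines of rank 1 span a space of rank [d]. *)
split=> //; apply/mxdirectP => /=.
rewrite (eqmx_rank full) mxrank1 -[LHS]card_ord -sum1_card.
by apply: eq_bigr => i _; rewrite genmxE rank_basis_vector.
Qed.

End Activation.

Unset Implicit Arguments.

Theorem corollary2 (R : realType) (gT : finGroupType) (G : {group gT})
    (d : nat) (rG : mx_representation R G d)
    (b : d.-tuple 'rV[R]_d) (f : R -> R) :
  basis_of fullv b ->
  continuous f ->
  ~ odd_function f ->
  ~ affine_function f ->
  equivariant rG (pointwise_activation b f) ->
  (disentangled rG b <-> sum_of_trivial_representations rG).
Proof.
move=> b_basis fC fodd faff eqv.
pose U (i : 'I_d) : 'M[R]_d := <<b`_i>>%MS.
have dsd := basis_direct_sum_decomposition b_basis.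
have rankU i : \rank (U i) = 1%N by rewrite genmxE (rank_basis_vector b_basis).
split=> [dis | triv].
  have G1 g gG := disentangled_fixed b_basis fC fodd faff eqv dis gG : rG g = 1%:M.
  exists d, U; split=> // i; split=> [||g gG v _].
  - exact: fixed_mxmodule.
  - exact: rankU.
  - by rewrite G1// mulmx1.
have G1 g gG := sum_of_trivial_fixed triv gG : rG g = 1%:M.
(* The given trivial components need not be adapted to [b]. As [G] acts trivially, the lines spanned
   by the basis vectors serve instead. *)
exists d, U; split=> // [i|v /(nthP 0)[j]].
  split=> [||W _ WU W0]; first exact: fixed_mxmodule.
  - by rewrite -mxrank_eq0 rankU.
  - by rewrite -(geq_leqif (mxrank_leqif_sup WU)) rankU lt0n mxrank_eq0.
rewrite size_tuple => jd <-; exists (Ordinal jd); split=> [|i ji].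
  by rewrite genmxE.
(* A basis vector lying in the line of another one would be in the intersection of that line with
   the sum of the others, which is zero by directness. *)
apply/eqP; apply: contraT => ij.
have := rank_basis_vector b_basis (Ordinal jd).
suff /eqP -> : b`_j == 0 by rewrite mxrank0.
have /mxdirect_sumsP/(_ i isT) := dsd.2.
rewrite -submx0 => <-; rewrite sub_capmx ji.
by rewrite (sumsmx_sup (Ordinal jd))// genmxE.
Qed.
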